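(* Let $(X,\mu)$ be a probability space, let $T\colon X\to X$ be an invertible ergodic ($\mu$-preserving) transformation, and let $A\colon X\to \mathrm{SL}(2,\mathbb{R})$ be a measurable function with $\int_X \log\|A\|\,d\mu<\infty$. Then for $\mu$-a.e. $x\in X$, $$ \limsup_{n\to\infty} \frac{1}{n} \log\rho(A^n(x)) = \lambda^{+}(A). $$
   Context: $\mathrm{SL}(2,\mathbb{R})$ is the group of real $2\times 2$ matrices of determinant $1$; $\|\cdot\|$ is the operator norm with respect to the Euclidean norm; $\rho(\cdot)$ is the spectral radius (the maximum absolute value of the eigenvalues). For $x\in X$ and $n\in\mathbb{N}$, $A^n(x)=A(T^{n-1}x)\cdots A(Tx)A(x)$. The upper Lyapunov exponent $\lambda^+(A)\ge 0$ is the number such that $$\lambda^{+}(A)=\lim_{n\to+\infty}\frac1n\log\|A^n(x)\|\quad\text{for $\mu$-a.e. } x\in X$$ (which exists under these conditions). *)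

(* Defs.v *)
From HB Require Import structures.
From mathcomp Require Import all_boot all_order all_algebra.
From mathcomp Require Import complex.
From mathcomp Require Import all_classical all_reals all_analysis.
Set Implicit Arguments.
Unset Strict Implicit.
Unset Printing Implicit Defensive.
Import Order.TTheory GRing.Theory Num.Theory.
Import numFieldNormedType.Exports.
Local Open Scope classical_set_scope.
Local Open Scope ring_scope.

Section MatrixNorms.
Context {R : realType} {n : nat}.

Definition enorm (v : 'cV[R]_n) : R := Num.sqrt (\sum_i v i 0 ^+ 2).

(* The library norm `|M| on matrices is the maximum of the absolute values of
   the entries, hence this separate definition. *)
Definition opnorm (M : 'M[R]_n) : R :=
  sup [set enorm (M *m v) | v in [set v : 'cV[R]_n | enorm v <= 1]].

(* The eigenvalues are the complex ones. For 0 < n they form a finite nonempty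
   set, so that this supremum is a maximum. *)
Definition spectral_radius (M : 'M[R]_n) : R :=
  sup [set ComplexField.Normc.normc z
      | z in [set z : R[i] | eigenvalue (map_mx (real_complex R) M) z]].

End MatrixNorms.

(* Measurability with respect to the Borel sigma-algebra of 'M[R]_n. *)
Definition borel_measurable_mx {R : realType} {n : nat} {d : measure_display}
    {X : measurableType d} (A : X -> 'M[R]_n) : Prop :=
  measurable_fun setT (A : X -> g_sigma_algebraType (@open 'M[R]_n)).

Section Dynamics.
Context {d : measure_display} {X : measurableType d} {R : realType}.
Variables (mu : probability X R) (T : X -> X).

Definition invertible_transformation : Prop :=
  measurable_fun setT T /\
  exists S : X -> X, [/\ measurable_fun setT S, cancel T S & cancel S T].

Definition measure_preserving : Prop :=
  forall B : set X, measurable B -> mu (T @^-1` B) = mu B.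

Definition ergodic : Prop :=
  measure_preserving /\
  forall B : set X, measurable B -> T @^-1` B = B ->
    mu B = 0%E \/ mu B = 1%E.

(* cocycle A n x = A (T^(n-1) x) *m ... *m A (T x) *m A x *)
Fixpoint cocycle {k : nat} (A : X -> 'M[R]_k) (n : nat) (x : X) : 'M[R]_k :=
  if n is m.+1 then A (iter m T x) *m cocycle A m x else 1%:M.

Definition is_upper_lyapunov {k : nat} (A : X -> 'M[R]_k) (l : R) : Prop :=
  {ae mu, forall x,
    (fun n : nat => n%:R^-1 * ln (opnorm (cocycle A n x))) @ \oo --> l}.

(* The number l with is_upper_lyapunov A l. It is unique, because mu is a
   probability; the value is junk when there is no such number. *)
Definition upper_lyapunov {k : nat} (A : X -> 'M[R]_k) : R :=
  get (is_upper_lyapunov A).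

End Dynamics.

(* Main.v *)
(* Write |.| for the Frobenius norm. The functions f_n = ln |A^n| are nonnegative
   and subadditive, so f_n / n converges almost everywhere to a constant c, which
   is the Lyapunov exponent; this follows from ergodicity, a greedy covering of
   orbits and the maximal inequality.

   The spectral radius rho of M in SL(2,R) satisfies |tr M| <= 2 rho and
   1 <= rho <= 4 |M|, so the limsup is at most c, and it remains to find
   infinitely many n with |tr A^n| >= e^((c - e) n). If this fails on a set of
   positive measure, a point x and its image T^n x, with n large, both lie in a
   set where failure and convergence of f_n / n are uniform. Put P = A^n(x) and
   Q = A^n(T^n x), so that Q P = A^(2n)(x): all three have norm close to
   e^(c n), e^(c n), e^(2 c n) and comparatively small trace. By the
   Cayley-Hamilton theorem Q P + P Q is then small, so that P Q is as large as
   Q P, whereas the entrywise product of P Q and Q P is bounded by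
   |tr (Q P)| |P| |Q| + |P|^2 + |Q|^2 + 1, which is much smaller than
   |Q P|^2. *)

Require Import Defs.
From HB Require Import structures.
From mathcomp Require Import all_boot all_order all_algebra.
From mathcomp Require Import complex.
From mathcomp Require Import all_classical all_reals all_analysis.
From mathcomp Require Import measurable_realfun ring lra.
Set Implicit Arguments.
Unset Strict Implicit.
Unset Printing Implicit Defensive.
Import Order.TTheory GRing.Theory Num.Theory.
Import numFieldNormedType.Exports.
Local Open Scope classical_set_scope.
Local Open Scope ring_scope.

(** * Matrices of SL(2,R) *)

Lemma sum_ord2 (V : nmodType) (F : 'I_2 -> V) : \sum_i F i = F 0 + F 1.
Proof. by rewrite !big_ord_recl big_ord0 addr0; congr (_ + F _); exact: val_inj. Qed.

Lemma ord2_cases (P : 'I_2 -> Prop) : P 0 -> P 1 -> forall i, P i.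
Proof.
move=> P0 P1 [[|[|//]] Hi].
  by rewrite (_ : Ordinal Hi = 0)//; exact: val_inj.
by rewrite (_ : Ordinal Hi = 1)//; exact: val_inj.
Qed.

(** * Frobenius and operator norms of 2 x 2 matrices *)

Section Frobenius.
Context {R : realType}.
Implicit Types M N P Q : 'M[R]_2.

Definition frob M : R := Num.sqrt (\sum_i \sum_j M i j ^+ 2).

Lemma mxE2 M N i j : (M *m N) i j = M i 0 * N 0 j + M i 1 * N 1 j.
Proof. by rewrite mxE sum_ord2. Qed.

Lemma det_mx2 M : \det M = M 0 0 * M 1 1 - M 0 1 * M 1 0.
Proof.
rewrite (expand_det_row _ 0) sum_ord2 /cofactor !det_mx11 !mxE /=.
have -> : lift 0 0 = 1 :> 'I_2 by exact: val_inj.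
have -> : lift 1 0 = 0 :> 'I_2 by exact: val_inj.
by rewrite addn0 addn1/= expr0 expr1; ring.
Qed.

Lemma tr_mx2 M : \tr M = M 0 0 + M 1 1.
Proof. exact: sum_ord2. Qed.

Lemma sqr_frob M :
  frob M ^+ 2 = M 0 0 ^+ 2 + M 0 1 ^+ 2 + M 1 0 ^+ 2 + M 1 1 ^+ 2.
Proof.
by rewrite sqr_sqrtr !sum_ord2 ?addrA// !addr_ge0 ?sqr_ge0.
Qed.

Lemma frob_ge0 M : 0 <= frob M.
Proof. exact: sqrtr_ge0. Qed.

Lemma frobM M N : frob (M *m N) <= frob M * frob N.
Proof.
rewrite -(@ler_pXn2r _ 2) ?nnegrE ?mulr_ge0 ?frob_ge0// exprMn !sqr_frob !mxE2.
rewrite -subr_ge0.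
set a := M 0 0; set b := M 0 1; set c := M 1 0; set d := M 1 1.
set x := N 0 0; set y := N 0 1; set z := N 1 0; set t := N 1 1.
(* Lagrange's identity: each square is the defect in the Cauchy-Schwarz inequality for one row of
   [M] and one column of [N]. *)
rewrite (_ : _ - _ = (a * z - b * x) ^+ 2 + (a * t - b * y) ^+ 2
   + (c * z - d * x) ^+ 2 + (c * t - d * y) ^+ 2); last by ring.
by rewrite !addr_ge0 ?sqr_ge0.
Qed.

Lemma entry_le_frob M i j : `|M i j| <= frob M.
Proof.
rewrite -(@ler_pXn2r _ 2) ?nnegrE ?frob_ge0// real_normK ?num_real// sqr_frob.
have := (sqr_ge0 (M 0 0), sqr_ge0 (M 0 1), sqr_ge0 (M 1 0), sqr_ge0 (M 1 1)).
move=> [[[? ?] ?] ?].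
by move: i j; apply: ord2_cases; apply: ord2_cases; lra.
Qed.

(** Otherwise each of the four squared entries would be less than a quarter of their sum. *)
Lemma frob_le_entry M : exists i j, frob M <= 2 * `|M i j|.
Proof.
apply/not_existsP => H.
have {H}H i j : `|M i j| ^+ 2 < (frob M / 2) ^+ 2.
  have /negP : ~ (frob M <= 2 * `|M i j|) by move=> ?; apply: (H i); exists j.
  rewrite -ltNge => h; rewrite ltr_pXn2r ?nnegrE ?divr_ge0 ?frob_ge0//.
  by rewrite ltr_pdivlMr// mulrC.
have := (H 0 0, H 0 1, H 1 0, H 1 1).
rewrite !real_normK ?num_real// !expr_div_n.
have := sqr_frob M; move=> E [[[? ?] ?] ?]; lra.
Qed.

Lemma frob_ge1 M : \det M = 1 -> 1 <= frob M.
Proof.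
rewrite det_mx2 => d1.
rewrite -(@ler_pXn2r _ 2) ?nnegrE ?frob_ge0// expr1n sqr_frob.
(* The two squares add up to [frob M ^+ 2 - 2 * \det M]. *)
have := sqr_ge0 (M 0 0 - M 1 1); have := sqr_ge0 (M 0 1 + M 1 0).
rewrite !sqrrD !sqrrN; nra.
Qed.

Lemma tr_le_frob M : `|\tr M| <= 2 * frob M.
Proof.
rewrite tr_mx2 (le_trans (ler_normD _ _))//.
have := entry_le_frob M 0 0; have := entry_le_frob M 1 1; lra.
Qed.

Lemma enorm_mulmx M (v : 'cV[R]_2) : enorm (M *m v) <= frob M * enorm v.
Proof.
have sq (w : 'cV[R]_2) : enorm w ^+ 2 = w 0 0 ^+ 2 + w 1 0 ^+ 2.
  by rewrite sqr_sqrtr ?sum_ord2// addr_ge0// sqr_ge0.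
have e0 (w : 'cV[R]_2) : 0 <= enorm w by exact: sqrtr_ge0.
rewrite -(@ler_pXn2r _ 2) ?nnegrE ?mulr_ge0 ?frob_ge0// exprMn sqr_frob !sq.
rewrite !mxE !sum_ord2.
rewrite -subr_ge0.
set a := M 0 0; set b := M 0 1; set c := M 1 0; set d := M 1 1.
set x := v 0 0; set y := v 1 0.
rewrite (_ : _ - _ = (a * y - b * x) ^+ 2 + (c * y - d * x) ^+ 2); last by ring.
by rewrite !addr_ge0 ?sqr_ge0.
Qed.

Lemma opnorm_has_sup M :
  has_sup [set enorm (M *m v) | v in [set v : 'cV[R]_2 | enorm v <= 1]].
Proof.
split.
  exists (enorm (M *m 0)); exists 0 => //=.
  rewrite /enorm big1 ?sqrtr0 ?ler01// => i _; by rewrite mxE expr0n.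
exists (frob M) => _ [v /= v1 <-]; rewrite (le_trans (enorm_mulmx _ _))//.
by rewrite ler_piMr ?frob_ge0.
Qed.

Lemma opnorm_le_frob M : opnorm M <= frob M.
Proof.
apply: sup_le_ub; first exact: (opnorm_has_sup M).1.
move=> _ [v /= v1 <-]; rewrite (le_trans (enorm_mulmx _ _))//.
by rewrite ler_piMr ?frob_ge0.
Qed.

Lemma col_le_opnorm M j : Num.sqrt (M 0 j ^+ 2 + M 1 j ^+ 2) <= opnorm M.
Proof.
apply: sup_upper_bound; first exact: opnorm_has_sup.
exists (delta_mx j 0).
  rewrite /= /enorm (bigD1 j)//= big1 => [|i ij]; rewrite !mxE ?eqxx ?(negPf ij)/=.
    by rewrite expr1n addr0 sqrtr1.
  by rewrite expr0n.
by rewrite -colE /enorm sum_ord2 !mxE.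
Qed.

Lemma entry_le_opnorm M i j : `|M i j| <= opnorm M.
Proof.
apply: le_trans (col_le_opnorm M j).
rewrite -sqrtr_sqr ler_wsqrtr//; move: i; apply: ord2_cases.
  by rewrite lerDl sqr_ge0.
by rewrite lerDr sqr_ge0.
Qed.

Lemma frob_le_opnorm M : frob M <= 2 * opnorm M.
Proof.
have [i [j h]] := frob_le_entry M.
by rewrite (le_trans h)// ler_pM2l// entry_le_opnorm.
Qed.

(** If both columns were shorter than 1, the squared entries would add up to less than 2, whereas
    their sum is at least 2 det M. *)
Lemma opnorm_ge1 M : \det M = 1 -> 1 <= opnorm M.
Proof.
rewrite det_mx2 => d1; rewrite leNgt; apply/negP => o1.
have H j : M 0 j ^+ 2 + M 1 j ^+ 2 < 1.
  have := le_lt_trans (col_le_opnorm M j) o1.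
  by rewrite -[X in _ < X]sqrtr1 ltr_sqrt.
have := H 0; have := H 1.
have := sqr_ge0 (M 0 0 - M 1 1); have := sqr_ge0 (M 0 1 + M 1 0).
rewrite !sqrrD !sqrrN; nra.
Qed.

End Frobenius.

(** * Complex eigenvalues and spectral radius in SL(2,R) *)

Section Spectrum.
Context {R : realType}.
Implicit Types M : 'M[R]_2.
Local Notation normc := (@ComplexField.Normc.normc R).
Local Notation toC := (real_complex R).

Lemma eigenvalue_mx2 M (z : R[i]) : \det M = 1 ->
  eigenvalue (map_mx toC M) z = (z ^+ 2 - toC (\tr M) * z + 1 == 0).
Proof.
move=> d1; rewrite eigenvalue_root_char /root; congr (_ == _).
set N := map_mx toC M.
have s : size (char_poly N) = 3 by rewrite size_char_poly.
rewrite horner_coef s !big_ord_recl big_ord0 /= addr0.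
rewrite char_poly_det det_map_mx d1 rmorph1 sqrrN expr1n mul1r.
have -> : (char_poly N)`_(bump 0 0) = - toC (\tr M).
  by rewrite (_ : bump 0 0 = 2.-1)// char_poly_trace// trace_map_mx.
have -> : (char_poly N)`_(bump 0 (bump 0 0)) = 1.
  by have := monicP (char_poly_monic N); rewrite /lead_coef s.
rewrite /bump/= !addn0 expr0 expr1; ring.
Qed.

Lemma normcM (z w : R[i]) : normc (z * w) = normc z * normc w.
Proof. exact: ComplexField.Normc.normcM. Qed.

Lemma normc_real (x : R) : normc (toC x) = `|x|.
Proof. by rewrite /= expr0n addr0 sqrtr_sqr. Qed.

(** If |z| > 1, the equation z^2 = (tr M) z - 1 gives |z| <= |tr M| + 1, and |tr M| is at most twice
    the Frobenius norm, which is at least 1. *)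
Lemma eigenvalue_le M (z : R[i]) : \det M = 1 ->
  eigenvalue (map_mx toC M) z -> normc z <= 4 * frob M.
Proof.
move=> d1; rewrite eigenvalue_mx2// => /eqP e.
have f1 := frob_ge1 d1; have tf := tr_le_frob M.
have [z1|z1] := leP (normc z) 1; first lra.
have : normc z ^+ 2 <= `|\tr M| * normc z + 1.
  rewrite expr2 -normcM -normc_real -normcM.
  have -> : z * z = toC (\tr M) * z + - 1.
    by apply/eqP; rewrite -subr_eq0 -e; apply/eqP; ring.
  rewrite (le_trans (le_normcD _ _))//.
  by rewrite normcN ComplexField.Normc.normc1.
nra.
Qed.

Lemma has_sup_spectrum M : \det M = 1 -> has_sup [set normc z
      | z in [set z : R[i] | eigenvalue (map_mx toC M) z]].
Proof.
move=> d1; split; last first.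
  by exists (4 * frob M) => _ [z /= zM <-]; exact: eigenvalue_le.
(* [Theorem7'] gives a complex eigenvalue, so the set under the supremum is nonempty. *)
have [z ez] := Theorem7' (map_mx toC M) isT.
by exists (normc z); exists z.
Qed.

(** By Vieta's formulas, tr M - z is an eigenvalue along with z; the two may coincide. *)
Lemma eigenvalue_pair M : \det M = 1 -> exists z w : R[i],
  [/\ eigenvalue (map_mx toC M) z, eigenvalue (map_mx toC M) w,
      z + w = toC (\tr M) & z * w = 1].
Proof.
move=> d1; have [_ [z /= ez _]] := (has_sup_spectrum d1).1.
set t := toC (\tr M).
have e : z ^+ 2 - t * z + 1 = 0 by apply/eqP; rewrite -eigenvalue_mx2.
exists z, (t - z); split; first exact: ez.
- rewrite eigenvalue_mx2// -/t; apply/eqP; rewrite -[RHS]e; ring.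
- by rewrite addrC subrK.
- by apply/eqP; rewrite -subr_eq0 -oppr_eq0 -e; apply/eqP; ring.
Qed.

Lemma eigenvalue_le_rho M z : \det M = 1 ->
  eigenvalue (map_mx toC M) z -> normc z <= spectral_radius M.
Proof.
move=> d1 ez; apply: sup_upper_bound; first exact: has_sup_spectrum.
by exists z.
Qed.

Lemma spectral_radius_le_frob M : \det M = 1 -> spectral_radius M <= 4 * frob M.
Proof.
move=> d1; apply: sup_le_ub; first exact: (has_sup_spectrum d1).1.
by move=> _ [z /= zM <-]; exact: eigenvalue_le.
Qed.

(** Two eigenvalues with product 1 cannot both have modulus below 1. *)
Lemma spectral_radius_ge1 M : \det M = 1 -> 1 <= spectral_radius M.
Proof.
move=> d1; have [z [w [ez ew _ zw]]] := eigenvalue_pair d1.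
have := eigenvalue_le_rho d1 ez; have := eigenvalue_le_rho d1 ew.
have : normc z * normc w = 1 by rewrite -normcM zw ComplexField.Normc.normc1.
have := sqrtr_ge0 0 : 0 <= Num.sqrt (0:R).
have : 0 <= normc w by case: (w) => ? ?; exact: sqrtr_ge0.
have : 0 <= normc z by case: (z) => ? ?; exact: sqrtr_ge0.
nra.
Qed.

Lemma tr_le_spectral_radius M : \det M = 1 -> `|\tr M| <= 2 * spectral_radius M.
Proof.
move=> d1; have [z [w [ez ew s _]]] := eigenvalue_pair d1.
rewrite -normc_real -s (le_trans (le_normcD _ _))//.
have := eigenvalue_le_rho d1 ez; have := eigenvalue_le_rho d1 ew; lra.
Qed.

End Spectrum.

(** * Traces and products of two matrices in SL(2,R) *)

Section TwoMatrices.
Context {R : realType}.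
Implicit Types P Q : 'M[R]_2.

(* Polarized Cayley-Hamilton identity. *)
Lemma anticommutator_entry P Q i j :
  `|(P *m Q) i j + (Q *m P) i j| <=
    `|\tr P| * frob Q + `|\tr Q| * frob P + `|\tr (Q *m P)| + `|\tr P * \tr Q|.
Proof.
have -> : (P *m Q) i j + (Q *m P) i j = \tr P * Q i j + \tr Q * P i j
    + (i == j)%:R * (\tr (Q *m P) - \tr P * \tr Q).
  rewrite !mxE2 !tr_mx2 !mxE2.
  by move: i j; do 2!apply: ord2_cases => /=; ring.
rewrite -[leRHS]addrA.
apply: (le_trans (ler_normD _ _)); apply: lerD.
  apply: (le_trans (ler_normD _ _)); rewrite !normrM.
  by apply: lerD; rewrite ler_wpM2l// entry_le_frob.
rewrite normrM; apply: (@le_trans _ _ (`|\tr (Q *m P) - \tr P * \tr Q|)).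
  by case: (i == j); rewrite ?normr1 ?mul1r// normr0 mul0r.
by rewrite (le_trans (ler_normB _ _)).
Qed.

(* If det P = 1, then P X P = tr(P X) P - adj X. Expanding Q (P X P) Q in this
   way, with X the elementary matrix E_ji, gives the two identities proved by [ring]. *)
Lemma commuted_entry_prod P Q i j : \det P = 1 -> \det Q = 1 ->
  `|(Q *m P) i j * (P *m Q) i j| <=
    `|\tr (Q *m P)| * (frob P * frob Q) + frob P ^+ 2 + frob Q ^+ 2 + 1.
Proof.
move=> dP dQ; set t := \tr (Q *m P).
(* [bd] serves the diagonal entries and [bd1] below the off-diagonal ones, where no constant term
   appears. *)
have bd (a b c d p q : R) : `|a| <= p -> `|b| <= p -> `|c| <= q -> `|d| <= q ->
    `|t * (a * c) + a * b + c * d + 1| <=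
      `|t| * (p * q) + p ^+ 2 + q ^+ 2 + 1.
  move=> ap bp cq dq.
  apply: (le_trans (ler_normD _ _)); apply: lerD; last by rewrite normr1.
  apply: (le_trans (ler_normD _ _)); apply: lerD; last by rewrite normrM expr2 ler_pM.
  apply: (le_trans (ler_normD _ _)); apply: lerD; last by rewrite normrM expr2 ler_pM.
  by rewrite !normrM ler_wpM2l// ler_pM.
have [[P00 P01] [P10 P11]] : (`|P 0 0| <= frob P /\ `|P 0 1| <= frob P) /\
  (`|P 1 0| <= frob P /\ `|P 1 1| <= frob P) by rewrite !entry_le_frob.
have [[Q00 Q01] [Q10 Q11]] : (`|Q 0 0| <= frob Q /\ `|Q 0 1| <= frob Q) /\
  (`|Q 1 0| <= frob Q /\ `|Q 1 1| <= frob Q) by rewrite !entry_le_frob.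
have bd1 (a c : R) : `|a| <= frob P -> `|c| <= frob Q ->
    `|t * (a * c) + a * a + c * c| <=
      `|t| * (frob P * frob Q) + frob P ^+ 2 + frob Q ^+ 2 + 1.
  move=> ap cq; rewrite -[leLHS]addr0; apply: lerD => //.
  apply: (le_trans (ler_normD _ _)); apply: lerD; last by rewrite normrM expr2 ler_pM.
  apply: (le_trans (ler_normD _ _)); apply: lerD; last by rewrite normrM expr2 ler_pM.
  by rewrite !normrM ler_wpM2l// ler_pM.
have {dP} dP : P 0 0 * P 1 1 - P 0 1 * P 1 0 = 1 by rewrite -det_mx2.
have {dQ} dQ : Q 0 0 * Q 1 1 - Q 0 1 * Q 1 0 = 1 by rewrite -det_mx2.
have NP11 : `|- P 1 1| <= frob P by rewrite normrN.
have NP00 : `|- P 0 0| <= frob P by rewrite normrN.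
have NQ11 : `|- Q 1 1| <= frob Q by rewrite normrN.
have NQ00 : `|- Q 0 0| <= frob Q by rewrite normrN.
rewrite !mxE2; move: i j; do 2!apply: ord2_cases.
- have := bd _ _ _ _ _ _ P00 NP11 Q00 NQ11; congr (`|_| <= _).
  rewrite /t tr_mx2 !mxE2.
  transitivity ((Q 0 0 * P 0 0 + Q 0 1 * P 1 0 + (Q 1 0 * P 0 1 + Q 1 1 * P 1 1))
     * (P 0 0 * Q 0 0)
     - P 0 0 * P 1 1 * (Q 0 0 * Q 1 1 - Q 0 1 * Q 1 0)
     - Q 0 0 * Q 1 1 * (P 0 0 * P 1 1 - P 0 1 * P 1 0)
     + (Q 0 0 * Q 1 1 - Q 0 1 * Q 1 0) * (P 0 0 * P 1 1 - P 0 1 * P 1 0)).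
    by rewrite dP dQ; ring.
  by ring.
- have := bd1 _ _ P01 Q01; congr (`|_| <= _).
  rewrite /t tr_mx2 !mxE2.
  (* Multiplying the square of [P 0 1] by det Q and that of [Q 0 1] by det P, both equal to 1, makes
     the identity homogeneous, hence provable by [ring]. *)
  rewrite -[X in _ + X + _]mulr1 -[X in _ + X = _]mulr1 -{1}dQ -{1}dP; ring.
- have := bd1 _ _ P10 Q10; congr (`|_| <= _).
  rewrite /t tr_mx2 !mxE2.
  rewrite -[X in _ + X + _]mulr1 -[X in _ + X = _]mulr1 -{1}dQ -{1}dP; ring.
- have := bd _ _ _ _ _ _ P11 NP00 Q11 NQ00; congr (`|_| <= _).
  rewrite /t tr_mx2 !mxE2.
  transitivity ((Q 0 0 * P 0 0 + Q 0 1 * P 1 0 + (Q 1 0 * P 0 1 + Q 1 1 * P 1 1))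
     * (P 1 1 * Q 1 1)
     - P 0 0 * P 1 1 * (Q 0 0 * Q 1 1 - Q 0 1 * Q 1 0)
     - Q 0 0 * Q 1 1 * (P 0 0 * P 1 1 - P 0 1 * P 1 0)
     + (Q 0 0 * Q 1 1 - Q 0 1 * Q 1 0) * (P 0 0 * P 1 1 - P 0 1 * P 1 0)).
    by rewrite dP dQ; ring.
  by ring.
Qed.

(** Put w = D^9 u^2. The largest entry m of Q P is at least 16 w, because D^5 >= 32. The
    anticommutator is at most 4 w, so the same entry n of P Q is at least 12 w. Then m n >= 192 w^2,
    against the bound 3 w^2 + 1 on the product. *)
Lemma two_matrices_large_tr P Q (u D : R) : \det P = 1 -> \det Q = 1 ->
  2 <= D -> 1 <= u ->
  frob P <= D ^+ 9 * u -> frob Q <= D ^+ 9 * u ->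
  D ^+ 14 * u ^+ 2 <= frob (Q *m P) ->
  `|\tr P| <= u -> `|\tr Q| <= u -> `|\tr (Q *m P)| <= u ^+ 2 -> False.
Proof.
move=> dP dQ D2 u1 fP fQ fQP tP tQ tQP.
have u0 : 0 <= u by lra.
have D0 : 0 <= D by lra.
have [fP0 fQ0] : 0 <= frob P /\ 0 <= frob Q by rewrite !frob_ge0.
have [i [j Hij]] := frob_le_entry (Q *m P).
have H1 := anticommutator_entry P Q i j.
have H2 := commuted_entry_prod i j dP dQ.
set v := u ^+ 2 in fQP tQP *.
have v1 : 1 <= v by rewrite exprn_ege1.
set a := D ^+ 9 in fP fQ.
have a0 : 512 <= a.
  have -> : 512 = 2 ^+ 9 :> R by ring.
  by rewrite lerXn2r// nnegrE; lra.
have e14 : D ^+ 14 = a * D ^+ 5 by rewrite -exprD.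
have b0 : 32 <= D ^+ 5.
  have -> : 32 = 2 ^+ 5 :> R by ring.
  by rewrite lerXn2r// nnegrE; lra.
set b := D ^+ 5 in e14 b0.
have A1 : `|(P *m Q) i j + (Q *m P) i j| <= 2 * (a * v) + 2 * v.
  apply: (le_trans H1).
  have -> : 2 * (a * v) + 2 * v = u * (a * u) + u * (a * u) + v + u * u.
    by rewrite /v; ring.
  by rewrite normrM !lerD ?ler_pM.
have A2 : `|(Q *m P) i j * (P *m Q) i j| <= 3 * (a ^+ 2 * v ^+ 2) + 1.
  apply: (le_trans H2); rewrite lerD//.
  have -> : 3 * (a ^+ 2 * v ^+ 2) = v * (a * u * (a * u)) + a ^+ 2 * v ^+ 2 + a ^+ 2 * v ^+ 2.
    by rewrite /v; ring.
  have av : (a * u) ^+ 2 <= a ^+ 2 * v ^+ 2.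
    by rewrite exprMn -/v ler_wpM2l ?sqr_ge0// expr2 ler_peMr//; lra.
  rewrite !lerD//.
  - by rewrite ler_pM// ?mulr_ge0// ler_pM.
  - by apply: le_trans av; rewrite lerXn2r// nnegrE mulr_ge0//; lra.
  - by apply: le_trans av; rewrite lerXn2r// nnegrE mulr_ge0//; lra.
move: A2; rewrite normrM.
set m := `|(Q *m P) i j| in Hij *; set n := `|(P *m Q) i j|.
have A3 : m - n <= `|(P *m Q) i j + (Q *m P) i j|.
  rewrite lerBlDr /m [leLHS](_ : _ = `|(P *m Q) i j + (Q *m P) i j - (P *m Q) i j|).
    exact: ler_normB.
  by congr (`|_|); ring.
set w := a * v.
have w512 : 512 <= w by rewrite /w; nra.
have -> : a ^+ 2 * v ^+ 2 = w ^+ 2 by rewrite /w; ring.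
have w0 : 0 <= w by lra.
have mw : 16 * w <= m.
  have := ler_wpM2r w0 b0; move: fQP.
  by rewrite e14 (_ : a * b * v = b * w) /w; [lra|ring].
have vw : v <= w by rewrite /w; nra.
have nw : 12 * w <= n by rewrite -/w in A1; lra.
nra.
Qed.

End TwoMatrices.

(** * Coverings of orbits and the maximal inequality *)

Section Coverings.
Context {R : realDomainType}.
Implicit Types (a : nat -> R) (I : pred nat).

(* Greedy covering: whenever I holds at the current time, jump over a block on
   which the average of a is at least t. *)
Lemma covering_le_sum a I (N : nat) (t : R) : 0 <= t -> (forall k, 0 <= a k) ->
  (forall k, I k -> exists l, [/\ (0 < l)%N, (l <= N)%N &
    t * l%:R <= \sum_(k <= i < k + l) a i]) ->
  forall n s, t * \sum_(s <= k < s + n) (I k)%:R <= \sum_(s <= i < s + n + N) a i.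
Proof.
move=> t0 a0 H.
have S0 p q : 0 <= \sum_(p <= i < q) a i by exact: sumr_ge0.
elim/ltn_ind => n IH s; case: n IH => [|n] IH.
  by rewrite addn0 big_geq// mulr0.
have [Is|nIs] := boolP (I s); last first.
  have sn : (s < s + n.+1)%N by rewrite addnS ltnS leq_addr.
  rewrite big_ltn// (negPf nIs) add0r [leRHS]big_ltn ?(leq_trans sn) ?leq_addr//.
  have := IH n (leqnn _) s.+1; rewrite addSnnS => /le_trans; apply.
  by rewrite lerDr.
have [l [l0 lN Hl]] := H s Is.
(* A block that overshoots the window ends within the [N] extra terms on the right; a shorter one is
   split off and the rest is left to induction. *)
have [nl|ln] := leqP n.+1 l.
  apply: (@le_trans _ _ (t * l%:R)).
    rewrite ler_wpM2l//; apply: (@le_trans _ _ (\sum_(s <= k < s + n.+1) 1)).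
      by apply: ler_sum => i _; case: (I i).
    by rewrite big_const_nat addKn iter_addr_0 -[1 *+ _]/(_%:R) ler_nat.
  apply: (le_trans Hl); rewrite [leRHS](@big_cat_nat _ _ _ (s + l)) ?leq_addr//=.
    by rewrite lerDl.
  by rewrite -addnA leq_add2l (leq_trans lN)// leq_addl.
rewrite (@big_cat_nat _ _ _ (s + l)) ?leq_addr ?leq_add2l ?(ltnW ln)//=.
rewrite [leRHS](@big_cat_nat _ _ _ (s + l)) ?leq_addr//=; last first.
  by rewrite -addnA leq_add2l (leq_trans (ltnW ln))// leq_addr.
rewrite mulrDr lerD//.
  apply: le_trans Hl; rewrite ler_wpM2l//.
  apply: (@le_trans _ _ (\sum_(s <= k < s + l) 1)).
    by apply: ler_sum => i _; case: (I i).
  by rewrite big_const_nat addKn iter_addr_0.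
have /IH : (n.+1 - l < n.+1)%N by rewrite ltn_subrL l0.
by move=> /(_ (s + l)%N); rewrite -addnA subnKC// ltnW.
Qed.

(* The same greedy covering applied to a subadditive g: either E holds at the
   current time, at the cost of one step of g, or a whole block grows at rate
   at most c. The last block is paid by N * K. *)
Lemma subadditive_covering (g : nat -> nat -> R) (E : pred nat) (N : nat) (c K : R) :
  0 <= c -> 0 <= K -> (forall s, 0 <= g s 1) ->
  (forall s m n, (0 < m)%N -> (0 < n)%N -> g s (m + n)%N <= g s m + g (s + m)%N n) ->
  (forall s, ~~ E s -> g s 1 <= K) ->
  (forall s, ~~ E s -> exists l, [/\ (0 < l)%N, (l <= N)%N & g s l <= c * l%:R]) ->
  forall n s, (0 < n)%N ->
    g s n <= c * n%:R + \sum_(s <= i < s + n) (if E i then g i 1 else 0)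
             + N%:R * K.
Proof.
move=> c0 K0 g0 gD EK Ec.
pose h i := if E i then g i 1 else 0.
have h0 i : 0 <= h i by rewrite /h; case: ifP.
have S0 p q : 0 <= \sum_(p <= i < q) h i by exact: sumr_ge0.
(* Moving by single steps only costs at most [K] at each time outside [E]; this pays for a final
   stretch of length at most [N]. *)
have short n s : (0 < n)%N -> g s n <= \sum_(s <= i < s + n) h i + n%:R * K.
  elim: n s => // -[|n] IH s _.
    rewrite addn1 big_nat1 mul1r /h; have [_|/EK] := boolP (E s).
      by rewrite lerDl.
    by rewrite add0r.
  rewrite -add1n (le_trans (gD s 1 n.+1 _ _))//.
  rewrite addnA (@big_cat_nat _ _ _ (s + 1)) ?leq_addr//= natrD mulrDl addrACA lerD//.
    rewrite addn1 big_nat1 mul1r /h; have [_|/EK] := boolP (E s).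
      by rewrite lerDl.
    by rewrite add0r.
  exact: IH.
elim/ltn_ind => n IH s n0.
have [nN|Nn] := leqP n N.
  apply: (le_trans (short n s n0)); rewrite lerD//.
    by rewrite lerDr mulr_ge0.
  by rewrite ler_wpM2r// ler_nat.
have step l : (0 < l)%N -> (l < n)%N ->
    g s l <= c * l%:R + \sum_(s <= i < s + l) h i ->
    g s n <= c * n%:R + \sum_(s <= i < s + n) h i + N%:R * K.
  move=> l0 ln Hl; rewrite -(subnKC (ltnW ln)).
  rewrite (le_trans (gD _ _ _ l0 _)) ?subn_gt0//.
  rewrite addnA (@big_cat_nat _ _ _ (s + l)) ?leq_addr//= natrD mulrDr.
  rewrite addrACA -[leRHS]addrA lerD//.
  by apply: IH; rewrite ?subn_gt0// ltn_subrL l0.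
have [Es|nEs] := boolP (E s); last first.
  have [l [l0 lN Hl]] := Ec s nEs; apply: (step l) => //.
    exact: leq_ltn_trans Nn.
  by rewrite (le_trans Hl)// lerDl.
(* Length 1 is treated apart: subadditivity is assumed for positive lengths only, so nothing can be
   split off. *)
have [->|n1] := eqVneq n 1%N.
  rewrite addn1 big_nat1 /h Es mulr1 addrAC lerDr addr_ge0// mulr_ge0//.
apply: (step 1%N) => //; first by rewrite ltn_neqAle eq_sym n1.
by rewrite addn1 big_nat1 /h Es lerDr mulr_ge0.
Qed.

End Coverings.

(** * Measurability of sets given by countable quantifiers and inequalities *)

Section MeasurableSets.
Context {d : measure_display} {X : measurableType d} {R : realType}.

Lemma measurable_existsn (P : nat -> X -> Prop) :
  (forall n, measurable [set x | P n x]) -> measurable [set x | exists n, P n x].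
Proof.
move=> mP; rewrite (_ : [set x | _] = \bigcup_n [set x | P n x]).
  exact: bigcupT_measurable.
by apply/seteqP; split => x /= [n]; [exists n|move=> _ ?; exists n].
Qed.

Lemma measurable_foralln (P : nat -> X -> Prop) :
  (forall n, measurable [set x | P n x]) -> measurable [set x | forall n, P n x].
Proof.
move=> mP; rewrite (_ : [set x | _] = \bigcap_n [set x | P n x]).
  exact: bigcapT_measurable.
by apply/seteqP; split => x /= H n; [move=> _|]; exact: H.
Qed.

Lemma measurable_and_prop (Q : Prop) (P : X -> Prop) :
  measurable [set x | P x] -> measurable [set x | Q /\ P x].
Proof.
move=> mP; have [q|nq] := pselect Q.
  rewrite (_ : [set x | _] = [set x | P x])//.
  by apply/seteqP; split => x /= => [[]|].
rewrite (_ : [set x | _] = set0); first exact: measurable0.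
by apply/seteqP; split => x /= => [[/nq]|].
Qed.

Lemma measurable_imply_prop (Q : Prop) (P : X -> Prop) :
  measurable [set x | P x] -> measurable [set x | Q -> P x].
Proof.
move=> mP; have [q|nq] := pselect Q.
  rewrite (_ : [set x | _] = [set x | P x])//.
  by apply/seteqP; split => x /= H; [exact: H|move=> _].
by rewrite (_ : [set x | _] = setT)//; apply/seteqP; split => x //= _ /nq.
Qed.

Lemma measurable_le (f g : X -> R) : measurable_fun setT f ->
  measurable_fun setT g -> measurable [set x | f x <= g x].
Proof.
move=> mf mg; rewrite -[X in measurable X]setTI.
by have := measurable_fun_ler mf mg measurableT (_ : measurable [set true]); apply.
Qed.

Lemma measurable_lt (f g : X -> R) : measurable_fun setT f ->
  measurable_fun setT g -> measurable [set x | f x < g x].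
Proof.
move=> mf mg; rewrite -[X in measurable X]setTI.
by have := measurable_fun_ltr mf mg measurableT (_ : measurable [set true]); apply.
Qed.

End MeasurableSets.

(** * Birkhoff sums of nonnegative functions under a measure-preserving map *)

Section MeasurePreserving.
Context {d : measure_display} {X : measurableType d} {R : realType}.
Variables (mu : probability X R) (T : X -> X).
Hypothesis mT : measurable_fun setT T.
Hypothesis mpT : measure_preserving mu T.

Lemma measurable_iter n : measurable_fun setT (iter n T).
Proof.
by elim: n => [|n IH]; [exact: measurable_id|exact: (measurableT_comp mT IH)].
Qed.

Lemma measurable_preimage_iter n (B : set X) :
  measurable B -> measurable (iter n T @^-1` B).
Proof. by move=> mB; rewrite -[X in measurable X]setTI; exact: (measurable_iter n). Qed.

Lemma measure_preimage_iter n (B : set X) :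
  measurable B -> mu (iter n T @^-1` B) = mu B.
Proof.
move=> mB; elim: n => // n IH.
rewrite -[RHS]IH -[RHS]mpT; last exact: measurable_preimage_iter.
by congr (mu _); apply/seteqP; split => x /=; rewrite -iterSr.
Qed.

Lemma integral_iter n (h : X -> \bar R) : measurable_fun setT h ->
  (forall x, 0 <= h x)%E -> (\int[mu]_x h (iter n T x) = \int[mu]_x h x)%E.
Proof.
move=> mh h0.
transitivity (\int[pushforward mu (iter n T)]_x h x)%E.
  by rewrite (ge0_integral_pushforward (measurable_iter n)).
apply: eq_measure_integral => [|mi B mB _]; first exact: measurable_iter.
exact: measure_preimage_iter.
Qed.

Lemma measurable_birkhoff_sum (h : X -> R) p q : measurable_fun setT h ->
  measurable_fun setT (fun x => \sum_(p <= i < q) h (iter i T x)).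
Proof.
move=> mh; apply: measurable_sum => i.
by apply: (measurableT_comp mh); exact: measurable_iter.
Qed.

Lemma integral_birkhoff_sum (h : X -> R) n : measurable_fun setT h ->
  (forall x, 0 <= h x) ->
  (\int[mu]_x (\sum_(0 <= i < n) h (iter i T x))%:E =
   n%:R%:E * \int[mu]_x (h x)%:E)%E.
Proof.
move=> mh h0; under eq_integral do rewrite -sumEFin.
rewrite ge0_integral_sum//=; last 2 first.
- move=> i; apply/measurable_EFinP.
  by apply: (measurableT_comp mh); exact: measurable_iter.
- by move=> i x _; rewrite lee_fin.
rewrite (eq_bigr (fun=> \int[mu]_x (h x)%:E)%E) => [|i _].
  by rewrite big_const_nat subn0 iter_addr_0 mule_natl.
apply: (integral_iter i (h := fun x => (h x)%:E)) => [|x].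
  exact/measurable_EFinP.
by rewrite lee_fin.
Qed.

(** The greedy covering bounds t times the number of visits to the set before time n by a Birkhoff
    sum of length n + N. Integrating, by invariance, and letting n tend to infinity makes the extra
    N terms negligible. *)
Lemma maximal_inequality_bounded (h : X -> R) (N : nat) (t : R) :
  measurable_fun setT h -> (forall x, 0 <= h x) -> 0 <= t ->
  (t%:E * mu [set x | exists n, ((0 < n)%N /\ (n <= N)%N) /\
      (t * n%:R <= \sum_(0 <= i < n) h (iter i T x))%R] <= \int[mu]_x (h x)%:E)%E.
Proof.
move=> mh h0 t0; set B := [set x | _].
have mB : measurable B.
  apply: measurable_existsn => n; apply: measurable_and_prop.
  by apply: measurable_le => //; exact: measurable_birkhoff_sum.
have muB : mu B \is a fin_num by exact: fin_num_measure.
set J := (\int[mu]_x _)%E.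
have J0 : (0 <= J)%E by apply: integral_ge0 => x _; rewrite lee_fin.
have key n : (t%:E * (n%:R%:E * mu B) <= (n + N)%:R%:E * J)%E.
  have -> : (n%:R%:E * mu B = \int[mu]_x (\sum_(0 <= i < n) \1_B (iter i T x))%:E)%E.
    by rewrite integral_birkhoff_sum// integral_indic// setIT.
  rewrite -integral_birkhoff_sum// -ge0_integralZl_EFin//; last 2 first.
  - by move=> x _; rewrite lee_fin sumr_ge0.
  - by apply/measurable_EFinP/measurable_birkhoff_sum.
  apply: ge0_le_integral => //.
  - by move=> x _; rewrite -EFinM lee_fin mulr_ge0// sumr_ge0.
  - apply/measurable_EFinP; apply: measurable_funM => //.
    exact: measurable_birkhoff_sum.
  - by apply/measurable_EFinP/measurable_birkhoff_sum.
  move=> x _; rewrite -EFinM lee_fin.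
  have := @covering_le_sum R (fun i => h (iter i T x))
    (fun i => iter i T x \in B) N t t0 (fun i => h0 _).
  move=> /(_ _ n 0%N); rewrite !add0n; apply=> k; rewrite inE /=.
  move=> [l [[l0 lN] Hl]]; exists l; split => //.
  apply: (le_trans Hl).
  rewrite [leRHS](_ : _ = \sum_(0 + k <= i < l + k) h (iter i T x)).
    by rewrite big_addn addnK; apply: ler_sum => i _; rewrite iterD.
  by rewrite add0n addnC.
move: key; rewrite -(fineK muB); set p := fine _.
have [->|Jy] := eqVneq J +oo%E; first by rewrite leey.
have Jfin : J \is a fin_num by rewrite ge0_fin_numE// ltey.
rewrite -(fineK Jfin); set j := fine J => key.
have j0 : 0 <= j by rewrite fine_ge0.
have {}key n : t * (n%:R * p) <= (n + N)%:R * j.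
  by have := key n; rewrite -!EFinM lee_fin.
rewrite -EFinM lee_fin leNgt; apply/negP => jtp.
have jtp' : 0 < t * p - j by rewrite subr_gt0.
(* If t p > j, an n beyond this quotient violates [key], which says n (t p - j) <= N j. *)
have q0 : 0 <= N%:R * j / (t * p - j) by rewrite divr_ge0 ?mulr_ge0// ltW.
have := archi_boundP q0; set n := Num.bound _.
rewrite ltr_pdivrMr// => Hn.
have := key n; rewrite natrD; nra.
Qed.

(** Continuity of the measure from below along the increasing sets [B N] removes the bound on block
    lengths. *)
Lemma maximal_inequality (h : X -> R) (t : R) :
  measurable_fun setT h -> (forall x, 0 <= h x) -> 0 <= t ->
  (t%:E * mu [set x | exists n, (0 < n)%N /\
      (t * n%:R <= \sum_(0 <= i < n) h (iter i T x))%R] <= \int[mu]_x (h x)%:E)%E.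
Proof.
move=> mh h0 t0.
pose B N := [set x | exists n, ((0 < n)%N /\ (n <= N)%N) /\
      t * n%:R <= \sum_(0 <= i < n) h (iter i T x)].
have mB N : measurable (B N).
  apply: measurable_existsn => n; apply: measurable_and_prop.
  by apply: measurable_le => //; exact: measurable_birkhoff_sum.
rewrite (_ : [set x | _] = \bigcup_N B N); last first.
  apply/seteqP; split => x /=.
    by move=> [n [n0 Hn]]; exists n => //; exists n; rewrite leqnn.
  by move=> [N _ [n [[n0 _] Hn]]]; exists n.
have ndB : nondecreasing_seq B.
  move=> M N MN; apply/subsetPset => x [n [[n0 nM] Hn]]; exists n.
  by rewrite n0 (leq_trans nM).
have cvgB := @nondecreasing_cvg_mu _ _ _ mu B mB (bigcupT_measurable B mB) ndB.
have := cvgeZl (y := t%:E) isT cvgB => {}cvgB.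
rewrite -(cvg_lim _ cvgB)//; apply: lime_le; first by apply/cvg_ex; eexists; exact: cvgB.
by apply: nearW => N; exact: maximal_inequality_bounded.
Qed.

End MeasurePreserving.

(** * The subadditive ergodic theorem *)

Lemma eventually_linear_le {R : realType} (a b C : R) : a < b ->
  exists N, forall n, (N <= n)%N -> a * n%:R + C <= b * n%:R.
Proof.
move=> ab; have ba : 0 < b - a by rewrite subr_gt0.
exists (Num.bound (`|C| / (b - a))) => n Nn.
have q0 : 0 <= `|C| / (b - a) by rewrite divr_ge0// ltW.
have := lt_le_trans (archi_boundP q0) (_ : _ <= n%:R); rewrite ler_nat => /(_ Nn).
by rewrite ltr_pdivrMr// => h; have := ler_norm C; lra.
Qed.

Lemma inv_succ_lt {R : realType} (e : R) : 0 < e -> exists k, k.+1%:R^-1 < e.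
Proof. by move=> /ltr_add_invr[k]; rewrite add0r; exists k. Qed.

(* Hypothesis fT, which a general subadditive process need not
   satisfy, makes [grows_above] exactly T-invariant. *)
Section Subadditive.
Context {d : measure_display} {X : measurableType d} {R : realType}.
Variables (mu : probability X R) (T : X -> X) (f : nat -> X -> R).
Hypothesis mT : measurable_fun setT T.
Hypothesis ergT : ergodic mu T.
Hypothesis mf : forall n, measurable_fun setT (f n).
Hypothesis f0 : forall n x, 0 <= f n x.
Hypothesis fD : forall m n x, f (m + n)%N x <= f m x + f n (iter m T x).
Hypothesis fT : forall n x, f n (T x) <= f 1 x + f n.+1 x.
Hypothesis intf : (\int[mu]_x (f 1 x)%:E < +oo)%E.

Let mpT : measure_preserving mu T := ergT.1.

Let J : \bar R := (\int[mu]_x (f 1 x)%:E)%E.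

Let J_fin : J \is a fin_num.
Proof. by rewrite ge0_fin_numE// integral_ge0// => x _; rewrite lee_fin. Qed.

(* This is the event liminf f_n / n > q. *)
Definition grows_above (q : R) : set X := [set x | exists k N, forall n, (N <= n)%N ->
  (q + k.+1%:R^-1) * n%:R <= f n x].

Lemma measurable_grows_above q : measurable (grows_above q).
Proof.
apply: measurable_existsn => k; apply: measurable_existsn => N.
apply: measurable_foralln => n; apply: measurable_imply_prop.
exact: measurable_le.
Qed.

(** By [fD] and [fT], moving from x to T x changes the values by at most [f 1 x], up to an index
    shift by one. For large n this is absorbed by lowering the margin from 1/(k+1) to 1/(k+2). *)
Lemma grows_above_invariant q : T @^-1` grows_above q = grows_above q.
Proof.
have e k : (q + k.+2%:R^-1 : R) < q + k.+1%:R^-1.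
  by rewrite ltrD2l ltf_pV2 ?posrE// ltr_nat.
apply/seteqP; split => x /= [k [N H]].
  exists k.+1; have [M HM] := eventually_linear_le (f 1 x + (q + k.+1%:R^-1)) (e k).
  exists (maxn N M).+1 => -[//|n]; rewrite ltnS geq_max => /andP[Nn Mn].
  have := H n Nn; have := fT n x; have := HM n.+1 (leqW Mn).
  rewrite (_ : n.+1%:R = n%:R + 1); last by rewrite natr1.
  by move: (q + k.+1%:R^-1) (q + k.+2%:R^-1) => a b; lra.
exists k.+1; have [M HM] := eventually_linear_le (f 1 x - (q + k.+1%:R^-1)) (e k).
exists (maxn N M) => n; rewrite geq_max => /andP[Nn Mn].
have := H n.+1 (leqW Nn); have := fD 1 n x; have := HM n Mn.
rewrite add1n (_ : n.+1%:R = n%:R + 1)/=; last by rewrite natr1.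
by move: (q + k.+1%:R^-1) (q + k.+2%:R^-1) => a b; lra.
Qed.

Lemma grows_above_le p q : p <= q -> grows_above q `<=` grows_above p.
Proof.
move=> pq x [k [N H]]; exists k, N => n Nn; apply: le_trans (H n Nn).
by rewrite ler_wpM2r// lerD2r.
Qed.

Lemma grows_above_zero_one q : mu (grows_above q) = 0%E \/ mu (grows_above q) = 1%E.
Proof.
apply: ergT.2; first exact: measurable_grows_above.
exact: grows_above_invariant.
Qed.

Lemma subadditive_le_sum n x : (0 < n)%N -> f n x <= \sum_(0 <= i < n) f 1 (iter i T x).
Proof.
case: n => // n _; elim: n => [|n IH]; first by rewrite big_nat1.
by rewrite big_nat_recr//= -addn1 (le_trans (fD _ _ _))// lerD2r.
Qed.

(** The almost sure value of liminf f_n / n: the events [grows_above q] decrease in q and have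
    measure 0 or 1. *)
Definition growth_rate : R := sup [set q | mu (grows_above q) = 1%E].

Lemma grows_above_neg q : q < 0 -> grows_above q = setT.
Proof.
move=> q0; apply/seteqP; split => // x _.
have [k kq] : exists k, k.+1%:R^-1 < - q by apply: inv_succ_lt; rewrite oppr_gt0.
exists k, 0%N => n _; apply: le_trans (f0 n x).
by rewrite mulr_le0_ge0// -lerBrDl sub0r ltW.
Qed.

(** Negative rates belong to the set because f is nonnegative. The integral of [f 1] is an upper
    bound: where f_n >= q n, the Birkhoff sum of [f 1] is also at least q n, and the maximal
    inequality applies. *)
Lemma has_sup_growth : has_sup [set q | mu (grows_above q) = 1%E].
Proof.
split.
  by exists (-1) => /=; rewrite grows_above_neg ?probability_setT// ltrN10.
exists (fine J) => q /= q1; have [q0|q0] := leP q 0.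
  by rewrite (le_trans q0)// fine_ge0// integral_ge0// => x _; rewrite lee_fin.
have := maximal_inequality mT mpT (mf 1) (f0 1) (ltW q0); set B := [set x | _].
have mB : measurable B.
  apply: measurable_existsn => n; apply: measurable_and_prop.
  by apply: measurable_le => //; exact: measurable_birkhoff_sum.
have : (mu (grows_above q) <= mu B)%E.
  apply: le_measure; rewrite ?inE//; first exact: measurable_grows_above.
  move=> x [k [N H]]; exists N.+1; split => //.
  apply: le_trans (subadditive_le_sum _ _) => //; apply: le_trans (H _ (leqnSn _)).
  by rewrite ler_wpM2r// lerDl.
rewrite q1 => B1; rewrite -/J -(fineK J_fin) -lee_fin; apply: le_trans.
by rewrite -[leLHS]mule1 lee_wpmul2l// lee_fin ltW.
Qed.

Lemma growth_rate_ge0 : 0 <= growth_rate.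
Proof.
rewrite leNgt; apply/negP => c0.
(* Half of a negative rate is a larger rate that is still negative, hence still in the set. *)
suff : growth_rate / 2 <= growth_rate by lra.
apply: sup_upper_bound; first exact: has_sup_growth.
by rewrite /= grows_above_neg ?probability_setT//; lra.
Qed.

Lemma ae_lower_growth e : 0 < e -> {ae mu, forall x, grows_above (growth_rate - e) x}.
Proof.
move=> e0; have [q /= q1 qe] := sup_adherent e0 has_sup_growth.
exists (~` grows_above q); split.
- by apply: measurableC; exact: measurable_grows_above.
- rewrite probability_setC ?q1 ?subee//; exact: measurable_grows_above.
- by move=> x /= H /(grows_above_le (ltW qe)).
Qed.

Lemma not_grows_above_le e x : 0 < e -> ~ grows_above (growth_rate + e) x ->
  exists2 l, (0 < l)%N & f l x <= (growth_rate + 2 * e) * l%:R.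
Proof.
move=> e0; apply: contra_notP => H.
have [k ke] := inv_succ_lt e0.
(* The threshold 1 makes the length found positive. *)
exists k, 1%N => n n1; rewrite leNgt; apply/negP => Hn; apply: H.
exists n => //; rewrite (le_trans (ltW Hn))// ler_wpM2r//.
by move: (k.+1%:R^-1) ke => a; lra.
Qed.

Lemma measure_grows_above_growth e : 0 < e -> mu (grows_above (growth_rate + e)) = 0%E.
Proof.
move=> e0; have [//|q1] := grows_above_zero_one (growth_rate + e).
have : growth_rate + e <= growth_rate.
  by apply: sup_upper_bound => //; exact: has_sup_growth.
by rewrite gerDl leNgt e0.
Qed.

(* The points at which the covering makes a single step: no block of length at
   most N has growth rate close to the expected one, or the step itself is large.
   These sets decrease to a null set as N grows. *)
Definition slow_block_free (e : R) (N : nat) : set X := [set x | N%:R < f 1 x \/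
  forall l, (0 < l)%N /\ (l <= N)%N -> (growth_rate + 2 * e) * l%:R < f l x].

Lemma measurable_slow_block_free e N : measurable (slow_block_free e N).
Proof.
apply: measurableU; first exact: measurable_lt.
apply: measurable_foralln => l; apply: measurable_imply_prop.
exact: measurable_lt.
Qed.

(** Dominated convergence with majorant [f 1]: almost everywhere the indicator vanishes once [N]
    exceeds both the length of one slow block and the value [f 1 x]. *)
Lemma slow_block_free_integral e : 0 < e ->
  (\int[mu]_x (\1_(slow_block_free e N) x * f 1 x)%:E @[N --> \oo] --> 0)%E.
Proof.
move=> e0; pose F N x := (\1_(slow_block_free e N) x * f 1 x)%:E.
have mF N : measurable_fun setT (F N).
  apply/measurable_EFinP; apply: measurable_funM => //.
  by apply: measurable_indic; exact: measurable_slow_block_free.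
have aeF : {ae mu, forall x, setT x -> F ^~ x @ \oo --> 0%E}.
  exists (grows_above (growth_rate + e)); split.
  - exact: measurable_grows_above.
  - exact: measure_grows_above_growth.
  move=> x /= H; apply: contrapT => /(not_grows_above_le e0)[l l0 Hl].
  apply: H => _; apply: cvg_near_cst; exists (maxn l (Num.bound (f 1 x))) => // N /=.
  rewrite geq_max => /andP[lN bN].
  rewrite /F indicE memNset ?mul0r//= => -[|/(_ l)].
    by apply/negP; rewrite -leNgt (le_trans (ltW (archi_boundP (f0 1 x))))// ler_nat.
  by rewrite l0 lN ltNge Hl => /(_ (conj isT isT)).
have [] := @dominated_convergence _ _ _ mu setT measurableT F (cst 0%E)
  (fun x => (f 1 x)%:E) mF (measurable_cst _) aeF.
- apply/integrableP; split; first exact/measurable_EFinP.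
  by under eq_integral do rewrite gee0_abs ?lee_fin//.
- apply: aeW => x N _; rewrite gee0_abs ?lee_fin ?mulr_ge0//.
  by rewrite indicE; case: (_ \in _); rewrite ?mul1r// mul0r.
by move=> _ _; rewrite integral0.
Qed.

(** Contains the event limsup f_n / n > growth_rate + 4 e. *)
Definition fast_growth (e : R) : set X := [set x | forall M, exists n, (M <= n)%N /\
  (growth_rate + 4 * e) * n%:R <= f n x].

(** The covering bounds f_n by (growth_rate + 2 e) n, plus N^2, plus a Birkhoff sum of [f 1] cut
    down to [slow_block_free]. On [fast_growth] that sum is at least e n for some n, so the maximal
    inequality bounds e times the measure by an integral that tends to 0. *)
Lemma measure_fast_growth e : 0 < e -> mu (fast_growth e) = 0%E.
Proof.
move=> e0; have c0 := growth_rate_ge0.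
have mB : measurable (fast_growth e).
  apply: measurable_foralln => M; apply: measurable_existsn => n.
  by apply: measurable_and_prop; exact: measurable_le.
have key N : (e%:E * mu (fast_growth e) <=
    \int[mu]_x (\1_(slow_block_free e N) x * f 1 x)%:E)%E.
  have mh : measurable_fun setT (fun x => \1_(slow_block_free e N) x * f 1 x).
    apply: measurable_funM => //.
    by apply: measurable_indic; exact: measurable_slow_block_free.
  have h0 x : 0 <= \1_(slow_block_free e N) x * f 1 x by rewrite mulr_ge0.
  apply: le_trans (maximal_inequality mT mpT mh h0 (ltW e0)).
  rewrite lee_wpmul2l ?lee_fin ?(ltW e0)//; apply: le_measure; rewrite ?inE//.
    apply: measurable_existsn => n; apply: measurable_and_prop.
    by apply: measurable_le => //; exact: (measurable_birkhoff_sum mT _ _ mh).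
  move=> x Bx.
  (* Beyond [M] the boundary cost N^2 is at most e n, half of the spare 2 e n. *)
  have [M HM] := eventually_linear_le (N%:R * N%:R) e0.
  have [n [Mn Hn]] := Bx M.+1; exists n; split; first exact: leq_ltn_trans Mn.
  have := @subadditive_covering R (fun s n => f n (iter s T x))
    (fun s => iter s T x \in slow_block_free e N) N (growth_rate + 2 * e) N%:R.
  have ce : 0 <= growth_rate + 2 * e by lra.
  move=> /(_ ce (ler0n _ _) (fun s => f0 1 _)).
  have sub s m p : (0 < m)%N -> (0 < p)%N -> f (m + p)%N (iter s T x) <=
      f m (iter s T x) + f p (iter (s + m) T x).
    by move=> _ _; rewrite (addnC s) iterD; exact: fD.
  have good s : iter s T x \notin slow_block_free e N ->
      f 1 (iter s T x) <= N%:R /\ exists l, [/\ (0 < l)%N, (l <= N)%N &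
        f l (iter s T x) <= (growth_rate + 2 * e) * l%:R].
    rewrite notin_setE /slow_block_free /= => /not_orP[/negP].
    rewrite -leNgt => ->; move=> /existsNP[l /not_implyP[[l0 lN]]].
    by move=> /negP; rewrite -leNgt; split => //; exists l.
  move=> /(_ sub (fun s h => (good s h).1) (fun s h => (good s h).2) n 0%N).
  have n0 : (0 < n)%N by exact: leq_ltn_trans Mn.
  move=> /(_ n0); rewrite add0n /=.
  under [X in _ + X + _]eq_bigr => i _.
    rewrite (_ : (if _ then _ else _) =
      \1_(slow_block_free e N) (iter i T x) * f 1 (iter i T x)); last first.
      by rewrite indicE; case: (_ \in _); rewrite ?mul1r ?mul0r.
    over.
  have := HM n (ltnW Mn); move: Hn; rewrite mul0r add0r; lra.
have muB0 : (0 <= mu (fast_growth e))%E by [].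
have : (e%:E * mu (fast_growth e) <= 0)%E.
  rewrite -(cvg_lim _ (slow_block_free_integral e0))//.
  apply: lime_ge; last exact: nearW.
  by apply/cvg_ex; eexists; exact: slow_block_free_integral.
rewrite pmule_rle0 ?lte_fin// => h; apply/eqP; rewrite eq_le h; exact: muB0.
Qed.

Lemma subadditive_ergodic :
  {ae mu, forall x, (fun n => n%:R^-1 * f n x) @ \oo --> growth_rate}.
Proof.
have lower j : {ae mu, forall x, grows_above (growth_rate - j.+1%:R^-1) x}.
  by apply: ae_lower_growth; rewrite invr_gt0.
have upper j : {ae mu, forall x, ~ fast_growth j.+1%:R^-1 x}.
  exists (fast_growth j.+1%:R^-1); split.
  - apply: measurable_foralln => M; apply: measurable_existsn => n.
    by apply: measurable_and_prop; exact: measurable_le.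
  - by apply: measure_fast_growth; rewrite invr_gt0.
  - by move=> x /= /contrapT.
have := ae_foralln lower; have := ae_foralln upper.
apply: filterS2 => x xu xl; apply/cvgrPdist_le => e e0.
(* The 4 is the factor in [fast_growth]. *)
have [j je] : exists j, j.+1%:R^-1 < e / 4 by apply: inv_succ_lt; rewrite divr_gt0.
have [k [N HN]] := xl j.
have /existsNP[M HM] := xu j.
exists (maxn (maxn N M) 1) => // n; rewrite /= !geq_max => /andP[/andP[Nn Mn] n1].
have n0 : 0 < n%:R :> R by rewrite ltr0n.
have jk : 0 <= k.+1%:R^-1 :> R by rewrite invr_ge0.
have A1 := HN n Nn.
have A2 : f n x <= (growth_rate + 4 * j.+1%:R^-1) * n%:R.
  rewrite leNgt; apply/negP => h; apply: HM; exists n; split => //; exact: ltW.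
rewrite ler_distlC; apply/andP; split.
  rewrite mulrC ler_pdivlMr//; apply: le_trans A1; rewrite ler_wpM2r//.
  by move: (j.+1%:R^-1) (k.+1%:R^-1) je jk => a b; lra.
rewrite mulrC ler_pdivrMr//; apply: (le_trans A2); rewrite ler_wpM2r//.
by move: (j.+1%:R^-1) je => a; lra.
Qed.

End Subadditive.

(** * Cocycles *)

Lemma limn_esup_fin {R : realType} (u : nat -> R) (l : R) :
  (forall e, 0 < e -> exists N, forall n, (N <= n)%N -> u n <= l + e) ->
  (forall e N, 0 < e -> exists2 n, (N <= n)%N & l - e <= u n) ->
  limn_esup (fun n => (u n)%:E) = l%:E.
Proof.
move=> upper lower; apply/eqP; rewrite eq_le; apply/andP; split.
  apply/lee_addgt0Pr => e /upper[N HN].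
  apply: (@le_trans _ _ (ereal_sup ((fun n => (u n)%:E) @` [set n | (N <= n)%N]))).
    by apply: ereal_inf_lbound; exists [set n | (N <= n)%N] => //; exists N.
  by apply: ge_ereal_sup => _ [n /= Nn <-]; rewrite lee_fin; exact: HN.
apply: le_ereal_inf_tmp => _ [V [N _ NV] <-].
apply/lee_subgt0Pr => e e0; have [n Nn Hn] := lower e N e0.
apply: (@le_trans _ _ (u n)%:E); first by rewrite -EFinB lee_fin.
by apply: ereal_sup_ubound; exists n => //; exact: NV.
Qed.

(* Unlike in [ge0_le_integral], the larger function need not be measurable. *)
Lemma ge0_le_integral_nonmeasurable {d : measure_display} {X : measurableType d}
    {R : realType} (mu : {measure set X -> \bar R}) (f g : X -> \bar R) :
  (forall x, 0 <= f x)%E -> (forall x, f x <= g x)%E ->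
  (\int[mu]_x f x <= \int[mu]_x g x)%E.
Proof.
move=> f0 fg; have g0 x : (0 <= g x)%E by exact: le_trans (fg x).
rewrite !ge0_integralTE//; apply: ereal_sup_le => _ [h /= hf <-].
by exists h => //= x; exact: le_trans (fg x).
Qed.

(** * Poincare recurrence *)

Section Recurrence.
Context {d : measure_display} {X : measurableType d} {R : realType}.
Variables (mu : probability X R) (T : X -> X).
Hypothesis mT : measurable_fun setT T.
Hypothesis mpT : measure_preserving mu T.

(** The preimages of B under the iterates of order k N are pairwise disjoint and equal in measure,
    so m mu(B) <= 1 for every m. *)
Lemma measure_never_returning (B : set X) (N : nat) : measurable B -> (0 < N)%N ->
  (forall x n, (N <= n)%N -> B x -> ~ B (iter n T x)) -> mu B = 0%E.
Proof.
move=> mB N0 H; pose F k := iter (k * N) T @^-1` B.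
have mF k : measurable (F k) by exact: measurable_preimage_iter.
have disj i j : (i < j)%N -> F i `&` F j = set0.
  move=> ij; apply/seteqP; split => // x [] /= Fi.
  rewrite /F /= -(subnK (ltnW ij)) mulnDl iterD; apply: H => //.
  by rewrite leq_pmull// subn_gt0.
have tF : trivIset setT F.
  apply/trivIsetP => i j _ _; rewrite neq_ltn => /orP[] ij; first exact: disj.
  by rewrite setIC; exact: disj.
have muB : mu B \is a fin_num by exact: fin_num_measure.
have key m : m%:R * fine (mu B) <= 1.
  rewrite -lee_fin EFinM fineK//.
  have mU : measurable (\big[setU/set0]_(k < m) F k).
    by apply: bigsetU_measurable => k _; exact: mF.
  apply: le_trans (probability_le1 mu mU); rewrite measure_bigsetU// (eq_bigr (fun=> mu B)).
    by rewrite big_const_ord iter_addr_0 mule_natl.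
  by move=> k _; exact: measure_preimage_iter.
rewrite -(fineK muB); congr EFin; apply/eqP; rewrite eq_le fine_ge0// andbT.
rewrite leNgt; apply/negP => p0.
have := archi_boundP (_ : 0 <= (fine (mu B))^-1); rewrite invr_ge0 => /(_ (ltW p0)).
by rewrite -(ltr_pM2l p0) mulfV ?gt_eqF// ltNge mulrC key.
Qed.

End Recurrence.

(** * The logarithmic norm of the cocycle as a subadditive process *)

Section Cocycle.
Context {d : measure_display} {X : measurableType d} {R : realType}.
Variables (T : X -> X) (A : X -> 'M[R]_2).

Lemma cocycleD m n x :
  cocycle T A (m + n) x = cocycle T A n (iter m T x) *m cocycle T A m x.
Proof.
elim: n => [|n IH]; first by rewrite addn0 mul1mx.
by rewrite addnS /= IH mulmxA addnC iterD.
Qed.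

Lemma cocycle1 x : cocycle T A 1 x = A x.
Proof. by rewrite /= mulmx1. Qed.

Hypothesis A_det : forall x, \det (A x) = 1.

Lemma det_cocycle n x : \det (cocycle T A n x) = 1.
Proof. by elim: n => [|n IH] /=; rewrite ?det1// det_mulmx IH A_det mul1r. Qed.

Let f n x := ln (frob (cocycle T A n x)).

Let frob_pos n x : frob (cocycle T A n x) \is Num.pos.
Proof. by rewrite posrE (lt_le_trans ltr01)// frob_ge1// det_cocycle. Qed.

Lemma ln_frob_cocycle_ge0 n x : 0 <= f n x.
Proof. by rewrite ln_ge0// frob_ge1// det_cocycle. Qed.

Lemma ln_frob_cocycleD m n x : f (m + n) x <= f m x + f n (iter m T x).
Proof.
rewrite /f -lnM// ler_ln//; last by rewrite rpredM.
by rewrite cocycleD mulrC frobM.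
Qed.

Lemma frob_adj (M : 'M[R]_2) : frob (\adj M) = frob M.
Proof.
have entries : [/\ \adj M 0 0 = M 1 1, \adj M 0 1 = - M 0 1,
    \adj M 1 0 = - M 1 0 & \adj M 1 1 = M 0 0].
  have l0 : lift 0 0 = 1 :> 'I_2 by exact: val_inj.
  have l1 : lift 1 0 = 0 :> 'I_2 by exact: val_inj.
  by split; rewrite mxE /cofactor det_mx11 !mxE ?l0 ?l1 /= ?addn0 ?add0n
    ?expr0 ?expr1 ?sqrrN ?expr1n ?mul1r ?mulN1r.
case: entries => e00 e01 e10 e11.
apply: (@pexpIrn _ 2) => //; rewrite ?nnegrE ?frob_ge0//.
by rewrite !sqr_frob e00 e01 e10 e11 !sqrrN; ring.
Qed.

(** A^n(T x) is A^(n+1)(x) times the inverse of A(x). In determinant 1 this inverse is the adjugate,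
    which has the same Frobenius norm as A(x). *)
Lemma ln_frob_cocycle_shift n x : f n (T x) <= f 1 x + f n.+1 x.
Proof.
rewrite /f -lnM// ler_ln//; last by rewrite rpredM.
have -> : cocycle T A n (T x) = cocycle T A n.+1 x *m \adj (A x).
  by rewrite -(add1n n) cocycleD cocycle1 -mulmxA mul_mx_adj A_det mulmx1.
by rewrite cocycle1 mulrC -(frob_adj (A x)) frobM.
Qed.

Hypothesis mT : measurable_fun setT T.
Hypothesis A_meas : borel_measurable_mx A.

(** An entry depends continuously on the matrix, so open rays, which generate the Borel sets of R,
    have open preimages. *)
Lemma measurable_entry i j : measurable_fun setT (fun x => A x i j).
Proof.
have mc : measurable_fun setT
    ((fun M : 'M[R]_2 => M i j) : g_sigma_algebraType (@open 'M[R]_2) -> R).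
  apply: (measurability (@RGenOInfty.G R)).
    exact: RGenOInfty.measurableE.
  move=> _ [_ [a ->] <-]; rewrite setTI; apply: sub_gen_smallest.
  by apply: open_comp; [move=> M _; exact: coord_continuous|exact: interval_open].
exact: (measurableT_comp mc A_meas).
Qed.

Lemma measurable_cocycle n i j : measurable_fun setT (fun x => cocycle T A n x i j).
Proof.
elim: n i j => [|n IH] i j /=; first exact: measurable_cst.
under eq_fun do rewrite mxE2.
have mAT k l : measurable_fun setT (fun x => A (iter n T x) k l).
  apply: (measurableT_comp (measurable_entry k l)); exact: measurable_iter.
by apply: measurable_funD; apply: measurable_funM.
Qed.

Lemma measurable_ln_frob_cocycle n : measurable_fun setT (f n).
Proof.
apply: (measurableT_comp (@measurable_ln R)).
rewrite /frob; apply: (measurableT_comp (continuous_measurable_fun (@sqrt_continuous R))).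
apply: measurable_sum => i; apply: measurable_sum => j.
apply: measurable_funX; exact: measurable_cocycle.
Qed.

Lemma measurable_tr_cocycle n : measurable_fun setT (fun x => \tr (cocycle T A n x)).
Proof.
under eq_fun do rewrite tr_mx2.
by apply: measurable_funD; exact: measurable_cocycle.
Qed.

(** The measurable function [g] mediates between the two norms: [f 1] is at most ln 2 + g, and g is
    at most the logarithm of the operator norm, since the norms differ by a factor of at most 2. *)
Lemma integral_ln_frob_lty (mu : probability X R) :
  (\int[mu]_x (ln (opnorm (A x)))%:E < +oo)%E ->
  (\int[mu]_x (f 1 x)%:E < +oo)%E.
Proof.
move=> A_int; pose g x := Num.max (f 1 x - ln 2) 0.
have mg : measurable_fun setT g.
  apply: measurable_maxr => //; apply: measurable_funB => //.
  exact: measurable_ln_frob_cocycle.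
have g0 x : 0 <= g x by rewrite le_max lexx orbT.
have ln2 : 0 <= ln (2 : R) by rewrite ln_ge0// ler1n.
apply: (@le_lt_trans _ _ (\int[mu]_x ((ln (2 : R))%:E + (g x)%:E))%E).
  apply: ge0_le_integral => //.
  - by move=> x _; rewrite lee_fin ln_frob_cocycle_ge0.
  - by apply/measurable_EFinP; exact: measurable_ln_frob_cocycle.
  - by apply/measurable_EFinP; exact: measurable_funD.
  - by move=> x _; rewrite -EFinD lee_fin -lerBlDl le_max lexx.
rewrite ge0_integralD//; last 2 first.
- by move=> x _; rewrite lee_fin.
- exact/measurable_EFinP.
rewrite integral_cst// [X in (_ * X + _)%E](_ : _ = 1%E) ?mule1; last first.
  exact: probability_setT.
apply: lte_add_pinfty; first exact: ltry.
apply: le_lt_trans A_int; apply: ge0_le_integral_nonmeasurable => x.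
  by rewrite lee_fin.
have o1 := opnorm_ge1 (A_det x).
have o0 : 0 < opnorm (A x) by rewrite (lt_le_trans ltr01).
have F0 : 0 < frob (A x) by rewrite (lt_le_trans ltr01)// frob_ge1.
rewrite lee_fin ge_max ln_ge0// andbT lerBlDl -lnM ?posrE// /f cocycle1.
by rewrite ler_ln ?posrE ?mulr_gt0// frob_le_opnorm.
Qed.

End Cocycle.

(** * Points whose norms grow at rate c while the traces stay smaller *)

Section SlowTrace.
Context {d : measure_display} {X : measurableType d} {R : realType}.
Variables (mu : probability X R) (T : X -> X) (A : X -> 'M[R]_2).
Hypothesis mT : measurable_fun setT T.
Hypothesis mpT : measure_preserving mu T.
Hypothesis A_det : forall x, \det (A x) = 1.
Hypothesis A_meas : borel_measurable_mx A.
Variables (c r : R).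
Hypothesis r0 : 0 < r.
Hypothesis rc : 8 * r <= c.

Definition slow_trace (N : nat) : set X := [set x | forall n, (N <= n)%N ->
  [/\ ln (frob (cocycle T A n x)) <= (c + r) * n%:R,
      (c - r) * n%:R <= ln (frob (cocycle T A n x)) &
      `|\tr (cocycle T A n x)| <= expR ((c - 8 * r) * n%:R)]].

Lemma measurable_slow_trace N : measurable (slow_trace N).
Proof.
apply: measurable_foralln => n; apply: measurable_imply_prop.
have mf := measurable_ln_frob_cocycle mT A_meas n.
rewrite (_ : [set x | _] =
    [set x | ln (frob (cocycle T A n x)) <= (c + r) * n%:R] `&`
    [set x | (c - r) * n%:R <= ln (frob (cocycle T A n x))] `&`
    [set x | `|\tr (cocycle T A n x)| <= expR ((c - 8 * r) * n%:R)]).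
  apply: measurableI; first by apply: measurableI; exact: measurable_le.
  apply: measurable_le => //; apply: (measurableT_comp (@normr_measurable R setT)).
  exact: measurable_tr_cocycle.
by apply/seteqP; split => x /= => [[]|[[]]].
Qed.

Let frobE n x : frob (cocycle T A n x) = expR (ln (frob (cocycle T A n x))).
Proof. by rewrite lnK// posrE (lt_le_trans ltr01)// frob_ge1// det_cocycle. Qed.

(** With D = e^(r n) and u = e^((c - 8 r) n), the norm bounds e^((c + r) n) and e^(2 (c - r) n) are
    D^9 u and D^14 u^2. The condition on [N] gives D >= 2. *)
Lemma slow_trace_never_returns N x n : ln 2 <= r * N%:R -> (N <= n)%N ->
  slow_trace N x -> ~ slow_trace N (iter n T x).
Proof.
move=> rN Nn Hx HTx.
have [P1 _ P3] := Hx n Nn; have [Q1 _ Q3] := HTx n Nn.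
have [_ S2 S3] := Hx (n + n)%N (leq_trans Nn (leq_addr _ _)).
pose D := expR (r * n%:R); pose u := expR ((c - 8 * r) * n%:R).
have DX k : D ^+ k = expR (k%:R * (r * n%:R)) by rewrite -expRM_natl.
have uX k : u ^+ k = expR (k%:R * ((c - 8 * r) * n%:R)) by rewrite -expRM_natl.
have D9 : D ^+ 9 * u = expR ((c + r) * n%:R).
  by rewrite DX -expRD; congr expR; ring.
apply: (@two_matrices_large_tr _ (cocycle T A n x) (cocycle T A n (iter n T x)) u D).
- exact: det_cocycle.
- exact: det_cocycle.
- rewrite -[leLHS]lnK ?posrE// ler_expR (le_trans rN)// ler_wpM2l ?ler_nat//.
  exact: ltW.
- by rewrite -[leLHS]expR0 ler_expR mulr_ge0// subr_ge0.
- by rewrite D9 frobE ler_expR.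
- by rewrite D9 frobE ler_expR.
- rewrite -cocycleD frobE DX uX -expRD ler_expR; apply: le_trans S2.
  by rewrite natrD; lra.
- exact: P3.
- exact: Q3.
- rewrite -cocycleD (le_trans S3)// uX ler_expR natrD.
  by rewrite [leLHS](_ : _ = 2%:R * ((c - 8 * r) * n%:R))//; ring.
Qed.

Lemma slow_trace_subset M N : (M <= N)%N -> slow_trace M `<=` slow_trace N.
Proof. by move=> MN x H n Nn; apply: H; exact: leq_trans Nn. Qed.

Lemma ae_not_slow_trace : {ae mu, forall x, forall N, ~ slow_trace N x}.
Proof.
apply: ae_foralln => N; exists (slow_trace N); split.
- exact: measurable_slow_trace.
(* The sets increase with the threshold, so it suffices to treat a threshold [M] so large that r M
   >= ln 2. *)
- pose M := maxn (maxn N 1) (Num.bound (ln 2 / r)).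
  have l2 : 0 <= ln 2 / r by rewrite divr_ge0 ?ln_ge0 ?ler1n// ltW.
  have rM : ln 2 <= r * M%:R.
    rewrite mulrC -ler_pdivrMr// (le_trans (ltW (archi_boundP l2)))//.
    by rewrite ler_nat leq_maxr.
  have M0 : mu (slow_trace M) = 0%E.
    apply: (@measure_never_returning _ _ _ mu T mT mpT _ M).
    + exact: measurable_slow_trace.
    + by rewrite /M !leq_max ltnS leqnn orbT.
    + by move=> x n Mn; exact: slow_trace_never_returns.
  apply/eqP; rewrite eq_le measure_ge0 andbT -M0.
  apply: le_measure; rewrite ?inE; [exact: measurable_slow_trace..|].
  by apply: slow_trace_subset; rewrite /M !leq_max leqnn.
- by move=> x /= /contrapT.
Qed.

End SlowTrace.

Lemma cvg_to_linear_bounds {R : realType} (u : nat -> R) (c e : R) : 0 < e ->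
  (fun n => n%:R^-1 * u n) @ \oo --> c ->
  exists N, forall n, (N <= n)%N -> (c - e) * n%:R <= u n <= (c + e) * n%:R.
Proof.
(* The successor excludes n = 0, where the inverse takes the default value 0. *)
move=> e0 /cvgrPdist_le/(_ e e0)[N _ HN]; exists N.+1 => n Nn.
have n0 : 0 < n%:R :> R by rewrite ltr0n (leq_trans _ Nn).
have := HN n (ltnW Nn); rewrite /= ler_distlC (mulrC _^-1).
by rewrite ler_pdivlMr// ler_pdivrMr.
Qed.

Lemma cvg_of_bounded_diff {R : realType} (u v : nat -> R) (c K : R) :
  (forall n, `|u n - v n| <= K) ->
  (fun n => n%:R^-1 * u n) @ \oo --> c -> (fun n => n%:R^-1 * v n) @ \oo --> c.
Proof.
move=> uv uc; apply/cvgrPdist_le => e e0.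
have e2 : 0 < e / 2 by rewrite divr_gt0.
have [N HN] := cvg_to_linear_bounds e2 uc.
have [M HM] := eventually_linear_le K e2.
exists (maxn (maxn N M) 1) => // n; rewrite /= !geq_max => /andP[/andP[Nn Mn] n1].
have n0 : 0 < n%:R :> R by rewrite ltr0n.
have /andP[H1 H2] := HN n Nn.
have := HM n Mn; have := uv n; rewrite ler_norml => /andP[U1 U2] H3.
rewrite ler_distlC mulrC ler_pdivlMr// ler_pdivrMr//.
apply/andP; split; nra.
Qed.

(** * The Lyapunov exponent and the growth of the spectral radius *)

Section SpectralGrowth.
Context {d : measure_display} {X : measurableType d} {R : realType}.
Variables (mu : probability X R) (T : X -> X) (A : X -> 'M[R]_2).
Hypothesis mT : measurable_fun setT T.
Hypothesis ergT : ergodic mu T.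
Hypothesis A_det : forall x, \det (A x) = 1.
Hypothesis A_meas : borel_measurable_mx A.
Hypothesis A_int : (\int[mu]_x (ln (opnorm (A x)))%:E < +oo)%E.

Let c := growth_rate mu (fun n x => ln (frob (cocycle T A n x))).

Lemma ae_cvg_ln_frob : {ae mu, forall x,
  (fun n => n%:R^-1 * ln (frob (cocycle T A n x))) @ \oo --> c}.
Proof.
apply: (subadditive_ergodic (f := fun n x => ln (frob (cocycle T A n x))) mT ergT).
- exact: measurable_ln_frob_cocycle.
- exact: ln_frob_cocycle_ge0.
- exact: ln_frob_cocycleD.
- exact: ln_frob_cocycle_shift.
- exact: integral_ln_frob_lty.
Qed.

(** The operator and Frobenius norms agree up to a factor 2, so their logarithms differ by at most
    ln 2, which disappears after division by n. *)
Lemma is_upper_lyapunov_growth_rate : is_upper_lyapunov mu T A c.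
Proof.
apply: filterS ae_cvg_ln_frob => x; apply: (@cvg_of_bounded_diff _ _ _ _ (ln 2)) => n.
have d1 := det_cocycle T A_det n x.
have f0 : 0 < frob (cocycle T A n x) by rewrite (lt_le_trans ltr01)// frob_ge1.
have o0 : 0 < opnorm (cocycle T A n x) by rewrite (lt_le_trans ltr01)// opnorm_ge1.
rewrite ger0_norm; last by rewrite subr_ge0 ler_ln ?posrE// opnorm_le_frob.
by rewrite lerBlDr -lnM ?posrE// ler_ln ?posrE ?mulr_gt0// frob_le_opnorm.
Qed.

Lemma upper_lyapunovE : upper_lyapunov mu T A = c.
Proof.
have H1 := is_upper_lyapunov_growth_rate.
have H2 : is_upper_lyapunov mu T A (upper_lyapunov mu T A).
  by apply: getPex; exists c.
have : {ae mu, forall x : X, upper_lyapunov mu T A = c}.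
  move: H1 H2; apply: filterS2 => x x1 x2.
  exact: (cvg_unique _ x2 x1).
(* The equality does not depend on x: if it failed, the null set [B] would be the whole space, of
   measure 1. *)
move=> [B [mB B0 sB]]; apply: contrapT => ne.
have : (mu setT <= mu B)%E by apply: le_measure; rewrite ?inE// => x _; exact: sB.
by rewrite B0 probability_setT lee_fin ler10.
Qed.

Lemma ae_limn_esup_spectral_radius : {ae mu, forall x,
  limn_esup (fun n => (n%:R^-1 * ln (spectral_radius (cocycle T A n x)))%:E) = c%:E}.
Proof.
(* The premise is the condition [rc] under which slow traces were excluded; the remaining case is a
   small c, treated separately below. *)
have tr j : {ae mu, forall x, 8 * j.+1%:R^-1 <= c ->
    forall N, ~ slow_trace T A c j.+1%:R^-1 N x}.
  have [h|h] := pselect (8 * j.+1%:R^-1 <= c); last by apply: aeW => x /h.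
  have j0 : 0 < j.+1%:R^-1 :> R by rewrite invr_gt0.
  by apply: filterS (ae_not_slow_trace mT ergT.1 A_det A_meas j0 h) => x H _.
have := ae_foralln tr; apply: filterS2 ae_cvg_ln_frob => x xc xtr.
have d1 n := det_cocycle T A_det n x.
pose rho n := spectral_radius (cocycle T A n x).
have rho1 n : 1 <= rho n by exact: spectral_radius_ge1.
have rho0 n : 0 < rho n by rewrite (lt_le_trans ltr01).
apply: limn_esup_fin => [e e0|e N e0].
  have e2 : 0 < e / 2 by rewrite divr_gt0.
  have [N HN] := cvg_to_linear_bounds e2 xc.
  have [M HM] := eventually_linear_le (ln 4) e2.
  exists (maxn (maxn N M) 1) => n; rewrite !geq_max => /andP[/andP[Nn Mn] n1].
  have n0 : 0 < n%:R :> R by rewrite ltr0n.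
  rewrite mulrC ler_pdivrMr//.
  have F0 : 0 < frob (cocycle T A n x) by rewrite (lt_le_trans ltr01)// frob_ge1.
  have : ln (rho n) <= ln 4 + ln (frob (cocycle T A n x)).
    rewrite -lnM ?posrE// ler_ln ?posrE ?mulr_gt0//.
    exact: spectral_radius_le_frob.
  rewrite /rho; have /andP[_ H2] := HN n Nn; have := HM n Mn; nra.
(* Eight parts are the gap in [slow_trace]; the ninth absorbs the ln 2 that comes from |tr M| <= 2
   rho. *)
have [j je] : exists j, j.+1%:R^-1 < e / 9 by apply: inv_succ_lt; rewrite divr_gt0.
have j0 : 0 < j.+1%:R^-1 :> R by rewrite invr_gt0.
(* If c is below 8/(j+1), then c - e is negative, and the logarithm of a spectral radius never
   is. *)
have [jc|cj] := leP (8 * j.+1%:R^-1) c; last first.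
  exists N => //; apply: (@le_trans _ _ 0).
    by move: (j.+1%:R^-1) j0 je cj => a; lra.
  by rewrite mulr_ge0//; exact/ln_ge0/rho1.
move: (j.+1%:R^-1) j0 je jc (xtr j jc) => a a0 ae ac Htr.
have [N1 HN1] := cvg_to_linear_bounds a0 xc.
have [M HM] := eventually_linear_le (ln 2) a0.
pose K := maxn (maxn (maxn N1 M) N) 1.
(* Past [K] both norm bounds of [slow_trace] hold, so only the trace bound can fail. *)
have [n Kn ntr] : exists2 n, (K <= n)%N &
    expR ((c - 8 * a) * n%:R) < `|\tr (cocycle T A n x)|.
  apply: contrapT => H; apply: (Htr K) => n Kn.
  have /andP[H1 H2] : (c - a) * n%:R <= ln (frob (cocycle T A n x)) <= (c + a) * n%:R.
    by apply: HN1; apply: leq_trans Kn; rewrite /K !leq_max leqnn.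
  split => //; rewrite leNgt; apply/negP => h; apply: H; by exists n.
move: Kn; rewrite /K !geq_max => /andP[/andP[/andP[_ Mn] Nn] n1].
exists n => //; have n0 : 0 < n%:R :> R by rewrite ltr0n.
rewrite mulrC ler_pdivlMr//.
have : (c - 8 * a) * n%:R <= ln 2 + ln (rho n).
  rewrite -lnM ?posrE// -ler_expR lnK ?posrE ?mulr_gt0//.
  by rewrite (le_trans (ltW ntr))// tr_le_spectral_radius.
rewrite /rho; have := HM n Mn; nra.
Qed.

End SpectralGrowth.

Theorem theorem15 (R : realType) (d : measure_display) (X : measurableType d)
    (mu : probability X R) (T : X -> X) (A : X -> 'M[R]_2)
    (T_inv : invertible_transformation T)
    (T_erg : ergodic mu T)
    (A_det : forall x, \det (A x) = 1)
    (A_meas : borel_measurable_mx A)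
    (A_int : (\int[mu]_x (ln (opnorm (A x)))%:E < +oo)%E) :
  {ae mu, forall x,
    limn_esup (fun n : nat =>
      (n%:R^-1 * ln (spectral_radius (cocycle T A n x)))%:E)
    = (upper_lyapunov mu T A)%:E}.
Proof.
rewrite (upper_lyapunovE T_inv.1 T_erg A_det A_meas A_int).
exact: (ae_limn_esup_spectral_radius T_inv.1 T_erg A_det A_meas A_int).
Qed.
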